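(* With the entrywise scalar multiplication by real numbers: (i) $(\mathbb R^\infty,\hat+)$ is a hyper vector space. (ii) $(\mathcal M_1,\bar+)$ is a hyper vector space, and $(\mathcal M_1,\hat+)$ is also a hyper vector space. (iii) For each positive rational $\mu=\mu_y/\mu_x$ (with $\mu_x,\mu_y\ge1$, $\gcd(\mu_y,\mu_x)=1$), $(\mathcal M_\mu,\hat+)$ is a hyper vector space, with identity set $\{0_{n\mu_y\times n\mu_x}: n\ge1\}$. (iv) $(\mathcal M,\hat+)$ is a hyper vector space.
   Context: $\mathbb R^\infty=\bigcup_{n\ge1}\mathbb R^n$, $\mathcal M_{m\times n}$ is the set of real $m\times n$ matrices, $\mathcal M=\bigcup_{m,n\ge1}\mathcal M_{m\times n}$ (disjoint unions), $\mathcal M_\mu=\{A\in\mathcal M_{m\times n}: m/n=\mu\}$, so $\mathcal M_1$ is the set of all square matrices; elements of $\mathcal M_\mu$ have size $m\mu_y\times m\mu_x$ for a unique $m$. $\otimes$ is the Kronecker product; $E_n=\frac1{\sqrt n}(1,\dots,1)^T\in\mathbb R^n$, $E_{m\times n}=E_mE_n^T$, $J_n=E_{n\times n}$. Additions: on $\mathbb R^\infty$, for $x\in\mathbb R^m,y\in\mathbb R^n,t=\mathrm{lcm}(m,n)$: $x\hat+y=x\otimes E_{t/m}+y\otimes E_{t/n}$. On $\mathcal M_1$, for $A\in\mathcal M_{m\times m},B\in\mathcal M_{n\times n},t=\mathrm{lcm}(m,n)$: $A\bar+B=A\otimes I_{t/m}+B\otimes I_{t/n}$ and $A\hat+B=A\otimes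 J_{t/m}+B\otimes J_{t/n}$. On $\mathcal M_\mu$, for $A\in\mathcal M_{m\mu_y\times m\mu_x},B\in\mathcal M_{n\mu_y\times n\mu_x},t=\mathrm{lcm}(m,n)$: $A\hat+B=A\otimes J_{t/m}+B\otimes J_{t/n}$. On $\mathcal M$, for $A\in\mathcal M_{m\times n},B\in\mathcal M_{p\times q},s=\mathrm{lcm}(m,p),t=\mathrm{lcm}(n,q)$: $A\hat+B=A\otimes E_{s/m\times t/n}+B\otimes E_{s/p\times t/q}$. Hyper group: Let $(G,* )$ be a semigroup. A subset $\mathbf e\subset G$ is an identity set if (i) $g*e=e*g$ for all $g\in G$, $e\in\mathbf e$; (ii) $\mathbf e=\{e_\lambda:\lambda\in\Lambda\}$ is indexed without repetition by a lattice $(\Lambda,\le)$ and $e_\lambda*e_\mu=e_{\lambda\vee\mu}$; (iii) for each $g\in G$ there is a unique $e_g=e_{\lambda_g}\in\mathbf e$ such that for all $\lambda\in\Lambda$: $e_\lambda*g=g$ if and only if $\lambda\le\lambda_g$. A hyper group is a semigroup with an identity set such that for each $g$ there is $g^{-1}\in G$ with $g*g^{-1}=g^{-1}*g=e_g$; abelian if $*$ is commutative. Hyper vector space over $\mathbb R$: a set $X$ with addition $+$ and scalar product $\cdot:\mathbb R\times X\to X$ such that $(X,+)$ is an abelian hyper group and $(r_1r_2)\cdot x=r_1\cdot(r_2\cdot x)$, $(r_1+r_2)\cdot x=r_1\cdot x+r_2\cdot x$, $r\cdot(x+y)=r\cdot x+r\cdot y$, $1\cdot x=x$. *)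

(* Defs.v *)
From HB Require Import structures.
From mathcomp Require Import all_boot all_order all_algebra.
From mathcomp Require Export mxtens.
From mathcomp Require Import classical_sets reals.

Set Implicit Arguments.
Unset Strict Implicit.
Unset Printing Implicit Defensive.

Import Order.TTheory GRing.Theory Num.Theory.

Local Open Scope classical_set_scope.
Local Open Scope ring_scope.

Section HyperGroup.
Variables (G : Type) (op : G -> G -> G).

(* [l] is the index lambda_g of the identity e_g of g. *)
Definition local_index d (L : latticeType d) (e : L -> G) (g : G) (l : L) :
    Prop :=
  forall k : L, op (e k) g = g <-> (k <= l)%O.

Record identity_family d (L : latticeType d) (e : L -> G) : Prop :=
  IdentityFamily {
    identity_comm : forall g l, op g (e l) = op (e l) g;
    identity_inj : injective e;
    identity_join : forall k l : L, op (e k) (e l) = e (k `|` l)%O;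
    identity_local : forall g, exists! l, local_index e g l
  }.

(* Since e_g is determined by the indexing of the identity set, the inverses
   are required for the same indexing lattice. *)
Definition hyper_group (E : set G) : Prop :=
  associative op /\
  exists (d : Order.disp_t) (L : latticeType d) (e : L -> G),
    [/\ E = range e, identity_family e &
        forall g, exists g' l,
          [/\ local_index e g l, op g g' = e l & op g' g = e l]].

Definition abelian_hyper_group (E : set G) : Prop :=
  commutative op /\ hyper_group E.

End HyperGroup.

Record hyper_vector_space_with (R : realType) (X : Type)
    (add : X -> X -> X) (scale : R -> X -> X) (E : set X) : Prop :=
  HyperVectorSpaceWith {
    hvs_group : abelian_hyper_group add E;
    hvs_scaleA : forall r1 r2 x, scale (r1 * r2) x = scale r1 (scale r2 x);
    hvs_scaleDl : forall r1 r2 x,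
      scale (r1 + r2) x = add (scale r1 x) (scale r2 x);
    hvs_scaleDr : forall r x y,
      scale r (add x y) = add (scale r x) (scale r y);
    hvs_scale1 : forall x, scale 1 x = x
  }.

Definition hyper_vector_space (R : realType) (X : Type)
    (add : X -> X -> X) (scale : R -> X -> X) : Prop :=
  exists E : set X, hyper_vector_space_with add scale E.

Lemma lcmn_divl (m n : nat) : (m * (lcmn m n %/ m) = lcmn m n)%N.
Proof. by rewrite mulnC divnK ?dvdn_lcml. Qed.

Lemma lcmn_divr (m n : nat) : (n * (lcmn m n %/ n) = lcmn m n)%N.
Proof. by rewrite mulnC divnK ?dvdn_lcmr. Qed.

Lemma lcmn_pos (m n : nat) : (0 < m)%N -> (0 < n)%N -> (0 < lcmn m n)%N.
Proof. by move=> m0 n0; rewrite lcmn_gt0 m0. Qed.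

Section Spaces.
Variable R : realType.

Definition Ecol (n : nat) : 'cV[R]_n := \col_(i < n) (Num.sqrt n%:R)^-1.
Definition Emx (m n : nat) : 'M[R]_(m, n) := Ecol m *m (Ecol n)^T.
Definition Jmx (n : nat) : 'M[R]_n := Emx n n.

Record rvec := RVec { dim : nat; dim_gt0 : (0 < dim)%N; vec : 'cV[R]_dim }.

Definition rvec_add (x y : rvec) : rvec :=
  let m := dim x in let n := dim y in let t := lcmn m n in
  RVec (lcmn_pos (dim_gt0 x) (dim_gt0 y))
    (castmx (lcmn_divl m n, muln1 1) (vec x *t Ecol (t %/ m)) +
     castmx (lcmn_divr m n, muln1 1) (vec y *t Ecol (t %/ n))).

Definition rvec_scale (r : R) (x : rvec) : rvec :=
  RVec (dim_gt0 x) (r *: vec x).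

Record rmat := RMat {
  nrow : nat; ncol : nat;
  nrow_gt0 : (0 < nrow)%N; ncol_gt0 : (0 < ncol)%N;
  mx : 'M[R]_(nrow, ncol) }.

Definition rmat_add (A B : rmat) : rmat :=
  let m := nrow A in let n := ncol A in
  let p := nrow B in let q := ncol B in
  let s := lcmn m p in let t := lcmn n q in
  RMat (lcmn_pos (nrow_gt0 A) (nrow_gt0 B))
       (lcmn_pos (ncol_gt0 A) (ncol_gt0 B))
    (castmx (lcmn_divl m p, lcmn_divl n q) (mx A *t Emx (s %/ m) (t %/ n)) +
     castmx (lcmn_divr m p, lcmn_divr n q) (mx B *t Emx (s %/ p) (t %/ q))).

Definition rmat_scale (r : R) (A : rmat) : rmat :=
  RMat (nrow_gt0 A) (ncol_gt0 A) (r *: mx A).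

Definition ratio (A : rmat) : rat := (nrow A)%:R / (ncol A)%:R.

Definition rmat_of (mu : rat) := {A : rmat | ratio A == mu}.

Section FixedRatio.
Variable mu : rat.
Implicit Types A B : rmat_of mu.

Let muy : nat := `|numq mu|.
Let mux : nat := `|denq mu|.

(* The unique m such that A has size m mu_y x m mu_x. *)
Definition level A : nat := nrow (val A) %/ muy.

Fact ratio_cross A : (nrow (val A) * mux = muy * ncol (val A))%N.
Proof.
case: A => -[m n m0 n0 M] /= /eqP; rewrite /ratio /= => e.
have n1 : n%:R != 0 :> rat by rewrite pnatr_eq0 -lt0n.
have mu0 : 0 < mu by rewrite -e divr_gt0 ?ltr0n.
have eN : mu = muy%:R / mux%:R.
  rewrite -{1}(divq_num_den mu) /muy /mux !natr_absz.
  by rewrite !ger0_norm ?denq_ge0 // ltW ?numq_gt0.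
have d1 : mux%:R != 0 :> rat by rewrite pnatr_eq0 absz_eq0 denq_eq0.
apply/eqP; rewrite -(eqr_nat rat) !natrM.
by rewrite -eqr_div // e eN.
Qed.

Fact muy_gt0 A : (0 < muy)%N.
Proof.
have := ratio_cross A; case: muy => // /eqP.
by rewrite mul0n muln_eq0 absz_eq0 denq_eq0 orbF gtn_eqF // nrow_gt0.
Qed.

Fact mux_gt0 : (0 < mux)%N.
Proof. by rewrite absz_gt0 denq_eq0. Qed.

Fact nrow_level A : nrow (val A) = (level A * muy)%N.
Proof.
rewrite divnK // -(@Gauss_dvdl _ _ mux) ?coprime_num_den //.
by rewrite ratio_cross dvdn_mulr.
Qed.

Fact ncol_level A : ncol (val A) = (level A * mux)%N.
Proof.
apply/eqP; rewrite -(eqn_pmul2l (muy_gt0 A)) -ratio_cross nrow_level.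
by apply/eqP; rewrite mulnAC mulnC.
Qed.

Fact level_gt0 A : (0 < level A)%N.
Proof. by have := nrow_gt0 (val A); rewrite nrow_level muln_gt0 => /andP[]. Qed.

Let tlevel A B := lcmn (level A) (level B).

Fact tlevel_gt0 A B : (0 < tlevel A B)%N.
Proof. by rewrite lcmn_pos ?level_gt0. Qed.

Fact sum_nrow_gt0 A B : (0 < tlevel A B * muy)%N.
Proof. by rewrite muln_gt0 tlevel_gt0 (muy_gt0 A). Qed.

Fact sum_ncol_gt0 A B : (0 < tlevel A B * mux)%N.
Proof. by rewrite muln_gt0 tlevel_gt0 mux_gt0. Qed.

Fact sum_nrowl A B :
  (nrow (val A) * (tlevel A B %/ level A) = tlevel A B * muy)%N.
Proof. by rewrite nrow_level mulnAC lcmn_divl. Qed.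

Fact sum_ncoll A B :
  (ncol (val A) * (tlevel A B %/ level A) = tlevel A B * mux)%N.
Proof. by rewrite ncol_level mulnAC lcmn_divl. Qed.

Fact sum_nrowr A B :
  (nrow (val B) * (tlevel A B %/ level B) = tlevel A B * muy)%N.
Proof. by rewrite nrow_level mulnAC lcmn_divr. Qed.

Fact sum_ncolr A B :
  (ncol (val B) * (tlevel A B %/ level B) = tlevel A B * mux)%N.
Proof. by rewrite ncol_level mulnAC lcmn_divr. Qed.

(* A (x) K_(t/m) + B (x) K_(t/n) with t = lcm(m, n), m and n being the levels
   of A and B. *)
Definition sum_mat (K : forall k, 'M[R]_k) A B : rmat :=
  let t := tlevel A B in
  RMat (sum_nrow_gt0 A B) (sum_ncol_gt0 A B)
    (castmx (sum_nrowl A B, sum_ncoll A B) (mx (val A) *t K (t %/ level A)%N) +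
     castmx (sum_nrowr A B, sum_ncolr A B) (mx (val B) *t K (t %/ level B)%N)).

Fact sum_mat_ratio K A B : ratio (sum_mat K A B) == mu.
Proof.
rewrite /ratio /=; case: A B => [A pA] [B pB].
set a := exist _ A pA; set b := exist _ B pB.
have t0 : (tlevel a b)%:R != 0 :> rat by rewrite pnatr_eq0 -lt0n tlevel_gt0.
have l0 : (level a)%:R != 0 :> rat by rewrite pnatr_eq0 -lt0n level_gt0.
have := pA; rewrite /ratio -[A]/(val a) nrow_level ncol_level.
by rewrite !natrM -!mulf_div !divff.
Qed.

Fact scale_ratio (r : R) A : ratio (rmat_scale r (val A)) == mu.
Proof. exact: (valP A). Qed.

Definition rmat_of_sum (K : forall k, 'M[R]_k) A B : rmat_of mu :=
  exist _ (sum_mat K A B) (sum_mat_ratio K A B).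

Definition rmat_of_scale (r : R) A : rmat_of mu :=
  exist _ (rmat_scale r (val A)) (scale_ratio r A).

Definition rmat_of_add_hat := rmat_of_sum Jmx.
Definition rmat_of_add_bar := rmat_of_sum (fun k => 1%:M).

End FixedRatio.

Definition zero_mats (mu : rat) (muy mux : nat) : set (rmat_of mu) :=
  [set A | exists n : nat,
     [/\ (0 < n)%N, nrow (val A) = (n * muy)%N, ncol (val A) = (n * mux)%N &
         mx (val A) = 0]].

End Spaces.

Arguments rvec_add {R}.
Arguments rvec_scale {R}.
Arguments rmat_add {R}.
Arguments rmat_scale {R}.
Arguments rmat_of_add_hat {R mu}.
Arguments rmat_of_add_bar {R mu}.
Arguments rmat_of_scale {R mu}.
Arguments zero_mats {R mu}.

(* Main.v *)
Require Import Defs.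
From mathcomp Require Import all_boot all_order all_algebra.
From mathcomp Require Import classical_sets reals.
From HB Require Import structures.
From mathcomp Require Import boolp functions.

Set Implicit Arguments.
Unset Strict Implicit.
Unset Printing Implicit Defensive.

Import Order.TTheory GRing.Theory Num.Theory.

(** All five structures are one construction, the strong semilattice of abelian
    groups (Plonka sum) over a lattice of sizes.  For each size [l] the elements
    of size [l] form a real vector space; whenever [k <= l] there is a linear
    transition map from size [k] to size [l], and these maps compose.  The sum
    of [x] and [y] is obtained by moving both to the join of their sizes and
    adding there.  Such a sum is always a hyper vector space
    ([plonka_sum_hvs]): associativity is functoriality of the transition maps,
    the identities are the zeros of the various sizes, and the zero of size
    [k] fixes [x] exactly when [k] lies below the size of [x], because
    otherwise the join is strictly larger than that size.

    For the concrete spaces the lattice is that of positive integers under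
    divisibility, whose join is the lcm, or its square for matrices of
    arbitrary shape.  The transition map from [m] to a multiple [l] is the
    Kronecker product with [U (l / m)], where [U] is the family of the E_n, of
    the E_(m x n), of the J_n, or of the identity matrices.  Functoriality is
    associativity of the Kronecker product together with the multiplicativity
    U (m n) = U m (x) U n, which holds for all four families because
    sqrt (m n) = sqrt m sqrt n ([EcolM], [EmxM]) and because a tensor product
    of identities is an identity ([scalar1_tens]).

    The sizes of both sides of such identities agree only propositionally.
    Casts are avoided by reading a matrix as a function on [nat * nat] that is
    zero outside the index range ([pad]); all sizes then live in a single
    vector space, and Kronecker multiplication becomes the total operation
    [kron] defined through quotients and remainders of the indices. *)

(** * Plonka sums of vector spaces *)

Section PlonkaSum.
Local Open Scope ring_scope.
Context (R : realType) (d : Order.disp_t) (L : latticeType d).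
Context (W : lmodType R) (X : Type).
Context (add : X -> X -> X) (scale : R -> X -> X).

(** The fibres are all embedded in one space [W], so that an element is
    determined by its size [deg] and its image [coord]; this avoids a family of
    spaces depending on the size.  The transition maps [tr k l] compose only
    along [k <= l <= m]. *)
Record plonka_sum (zero : L -> X) : Type := PlonkaSum {
  deg : X -> L;
  coord : X -> W;
  tr : L -> L -> W -> W;
  deg_coord_inj : forall x y, deg x = deg y -> coord x = coord y -> x = y;
  trD : forall k l, {morph tr k l : u v / u + v};
  trZ : forall k l, scalable (tr k l);
  tr_id : forall k u, tr k k u = u;
  tr_trans : forall k l m u, (k <= l)%O -> (l <= m)%O ->
    tr l m (tr k l u) = tr k m u;
  deg_add : forall x y, deg (add x y) = (deg x `|` deg y)%O;
  coord_add : forall x y, coord (add x y) =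
    tr (deg x) (deg x `|` deg y)%O (coord x) +
    tr (deg y) (deg x `|` deg y)%O (coord y);
  deg_scale : forall r x, deg (scale r x) = deg x;
  coord_scale : forall r x, coord (scale r x) = r *: coord x;
  deg_zero : forall l, deg (zero l) = l;
  coord_zero : forall l, coord (zero l) = 0
}.

Lemma plonka_sum_hvs (zero : L -> X) :
  plonka_sum zero -> hyper_vector_space_with add scale (range zero).
Proof.
case=> deg coord tr inj trD trZ tr_id tr_trans degD coordD degZ coordZ deg0 coord0.
have tr0 k l : tr k l 0 = 0 by rewrite -[in LHS](scale0r (0 : W)) trZ scale0r.
have addC : commutative add.
  by move=> x y; apply: inj; rewrite ?coordD ?degD joinC // addrC.
have addA : associative add.
  move=> x y z; apply: inj; first by rewrite !degD joinA.
  rewrite !coordD !trD !degD addrA joinA.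
  by rewrite !tr_trans ?leUl ?leUr // -joinA ?leUl ?leUr // joinCA leUl.
have same x y : deg x = deg y ->
    deg (add x y) = deg x /\ coord (add x y) = coord x + coord y.
  by move=> e; rewrite degD coordD -e joinxx !tr_id.
(* Adding a zero of level [k] only moves [x] up to level [deg x `|` k]. *)
have loc x : local_index add zero x (deg x).
  move=> k; split=> [e|le]; first by rewrite -[X in deg X]e degD deg0 leUl.
  apply: inj; first by rewrite degD deg0 (join_r le).
  by rewrite coordD deg0 (join_r le) coord0 tr0 add0r tr_id.
split.
- split=> //; split=> //; exists d, L, zero; split=> //.
    split=> [g l|k l e|k l|g]; first exact: addC.
    + by rewrite -(deg0 k) e deg0.
    + by apply: inj; rewrite ?coordD ?degD !deg0 // !coord0 !tr0 addr0.
    + exists (deg g); split=> // l lP; apply: le_anti; apply/andP; split.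
        by apply/lP/loc.
      by apply/loc/lP.
  move=> x; exists (scale (-1) x), (deg x).
  have e : add x (scale (-1) x) = zero (deg x).
    have [dE cE] := same x (scale (-1) x) (esym (degZ _ _)).
    apply: inj; rewrite ?dE ?cE ?deg0 ?coord0 //.
    by rewrite coordZ scaleN1r subrr.
  by split=> //; rewrite addC.
- by move=> r1 r2 x; apply: inj; rewrite ?degZ // !coordZ scalerA.
- move=> r1 r2 x; have [|dE cE] := same (scale r1 x) (scale r2 x).
    by rewrite !degZ.
  by apply: inj; rewrite ?dE ?cE ?degZ // !coordZ scalerDl.
- move=> r x y; apply: inj; first by rewrite !(degZ, degD).
  by rewrite coordZ !coordD !degZ !coordZ !trZ scalerDr.
- by move=> x; apply: inj; rewrite ?degZ // coordZ scale1r.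
Qed.

End PlonkaSum.

(** * Positive integers ordered by divisibility *)

Definition posdvd := {n : natdvd | 0 < (n : nat)}.

HB.instance Definition _ := SubChoice.on posdvd.

Lemma posdvd_closed :
  (forall m n : natdvd, 0 < (m : nat) -> 0 < (n : nat) ->
     0 < ((m `&` n)%O : nat)) /\
  (forall m n : natdvd, 0 < (m : nat) -> 0 < (n : nat) ->
     0 < ((m `|` n)%O : nat)).
Proof.
split=> m n m0 n0; first by rewrite -[(m `&` n)%O]/(gcdn m n) gcdn_gt0 m0.
by rewrite -[(m `|` n)%O]/(lcmn m n) lcmn_gt0 m0.
Qed.

HB.instance Definition _ :=
  Order.SubChoice_isSubLattice.Build _ _ _ Order.dvd_display posdvd
    posdvd_closed.1 posdvd_closed.2.

Definition posd (n : nat) (n0 : 0 < n) : posdvd := exist _ (n : natdvd) n0.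

(** A transition along [k | l | m] has the product of the two factors as its
    factor. *)
Lemma divn_trans k l m : k %| l -> l %| m ->
  m %/ k = (l %/ k) * (m %/ l).
Proof. by move=> kl lm; rewrite divn_mulAC // mulnC divnK. Qed.

(** * Zero-extended matrices and their Kronecker product *)

Section PaddedMatrices.
Local Open Scope ring_scope.
Variable R : realType.
Notation W := (nat -> nat -> R^o).

(** The zero extension makes a matrix of any size an element of the same
    vector space. *)
Definition pad m n (A : 'M[R]_(m, n)) : W := fun i j =>
  match insub i, insub j with
  | Some i', Some j' => A i' j'
  | _, _ => 0
  end.

(** This is f (x) u for a block [u] of size [p] by [q]: the quotients of the
    indices tell which entry of [f] multiplies the block, the remainders the
    position inside the block. *)
Definition kron (p q : nat) (u f : W) : W := fun i j =>
  f (i %/ p)%N (j %/ q)%N * u (i %% p)%N (j %% q)%N.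

Lemma padE m n (A : 'M[R]_(m, n)) (i : 'I_m) (j : 'I_n) : pad A i j = A i j.
Proof. by rewrite /pad !valK. Qed.

Lemma pad_out m n (A : 'M[R]_(m, n)) i j :
  ~~ ((i < m) && (j < n))%N -> pad A i j = 0.
Proof.
rewrite negb_and /pad => /orP[h|h].
  by rewrite (@insubN _ _ 'I_m).
by rewrite (@insubN _ _ 'I_n j) //; case: insub.
Qed.

Lemma pad_ext m n (A : 'M[R]_(m, n)) (f : W) :
    (forall (i : 'I_m) (j : 'I_n), A i j = f i j) ->
    (forall i j, ~~ ((i < m) && (j < n))%N -> f i j = 0) ->
  pad A = f.
Proof.
move=> fin fout; apply/funext=> i; apply/funext=> j.
have [/andP[im jn]|out] := boolP ((i < m) && (j < n))%N.
  by rewrite -[i]/(val (Ordinal im)) -[j]/(val (Ordinal jn)) padE fin.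
by rewrite pad_out ?fout.
Qed.

Lemma pad_inj m n : injective (@pad m n).
Proof. by move=> A B e; apply/matrixP=> i j; rewrite -!padE e. Qed.

Lemma pad_cast m n m' n' (e : (m = m') * (n = n')) (A : 'M[R]_(m, n)) :
  pad (castmx e A) = pad A.
Proof. by case: e => em en; case: _ / em; case: _ / en; rewrite castmx_id. Qed.

Lemma padD m n (A B : 'M[R]_(m, n)) : pad (A + B) = pad A + pad B.
Proof.
apply: pad_ext => [i j|i j out]; first by rewrite mxE !addrfctE /= !padE.
by rewrite !addrfctE /= !pad_out // addr0.
Qed.

Lemma padZ m n r (A : 'M[R]_(m, n)) : pad (r *: A) = r *: pad A.
Proof.
apply: pad_ext => [i j|i j out]; first by rewrite mxE !scalrfctE /= padE.
by rewrite !scalrfctE /= pad_out // scaler0.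
Qed.

Lemma pad0 m n : pad (0 : 'M[R]_(m, n)) = 0.
Proof. by apply: pad_ext => [i j|//]; rewrite mxE. Qed.

(** The identity extends past the range of the product because an index out of
    that range has a quotient out of the range of [A], or, when a dimension of
    the block is zero, a remainder out of the range of [B]. *)
Lemma pad_tens m n p q (A : 'M[R]_(m, n)) (B : 'M[R]_(p, q)) :
  pad (A *t B) = kron p q (pad B) (pad A).
Proof.
apply: pad_ext => [i j|i j out]; rewrite /kron.
  by rewrite mxE -!padE.
have [pq|/pad_out-> /[!mulr0]//] := boolP ((i %% p < p) && (j %% q < q))%N.
rewrite (@pad_out _ _ A) ?mul0r //; apply: contra out.
case: p q pq {B} => [|p] [|q]; rewrite ?modn0 ?ltn0 ?andbF // => _.
by rewrite !ltn_divLR.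
Qed.

(** In mixed radix, dividing by [p'] and then by [p] is dividing by their
    product, and the remainder modulo the product splits into two digits. *)
Lemma kronA p q p' q' (u v f : W) :
  kron (p * p') (q * q') (kron p' q' v u) f = kron p' q' v (kron p q u f).
Proof.
apply/funext=> i; apply/funext=> j; rewrite /kron.
rewrite mulrA ![(_ * p')%N]mulnC ![(_ * q')%N]mulnC -!divnMA.
rewrite !modn_divl !modn_dvdm ?dvdn_mulr //.
by rewrite ![(_ * p')%N]mulnC ![(_ * q')%N]mulnC.
Qed.

Lemma kron_tens m n p q (A : 'M[R]_(m, n)) (B : 'M[R]_(p, q)) f :
  kron (m * p) (n * q) (pad (A *t B)) f = kron p q (pad B) (kron m n (pad A) f).
Proof. by rewrite pad_tens kronA. Qed.

Lemma kron1 (f : W) : kron 1 1 (pad (1%:M : 'M[R]_1)) f = f.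
Proof.
apply/funext=> i; apply/funext=> j; rewrite /kron !divn1 !modn1.
by rewrite -[0%N]/(val (@ord0 0)) padE mxE mulr1.
Qed.

Lemma kronD p q u : {morph kron p q u : f g / f + g}.
Proof. by move=> f g; do 2![apply/funext=> ?]; exact: mulrDl. Qed.

Lemma kronZ p q u : scalable (kron p q u).
Proof. by move=> r f; do 2![apply/funext=> ?]; rewrite /kron -scalerAl. Qed.

(** * Multiplicative families of blocks *)

Lemma EcolM m n : Ecol R (m * n) = Ecol R m *t Ecol R n.
Proof.
by apply/matrixP=> i j; rewrite !mxE natrM sqrtrM ?ler0n // invfM.
Qed.

Lemma Ecol1 : Ecol R 1 = 1%:M.
Proof. by apply/matrixP=> i j; rewrite !ord1 !mxE sqrtr1 invr1. Qed.

Lemma EmxE m n i j :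
  Emx R m n i j = (Num.sqrt m%:R)^-1 * (Num.sqrt n%:R)^-1.
Proof. by rewrite mxE big_ord1 !mxE. Qed.

Lemma EmxM m n p q : Emx R (m * n) (p * q) = Emx R m p *t Emx R n q.
Proof.
apply/matrixP=> i j; rewrite EmxE mxE !EmxE !natrM !sqrtrM ?ler0n //.
by rewrite !invfM mulrACA.
Qed.

Lemma Emx1 : Emx R 1 1 = 1%:M.
Proof. by apply/matrixP=> i j; rewrite !ord1 EmxE mxE sqrtr1 invr1 mulr1. Qed.

Lemma scalar1_tens m n : 1%:M = (1%:M : 'M[R]_m) *t (1%:M : 'M[R]_n).
Proof.
apply/matrixP=> i j.
case: (mxtens_indexP i) => i1 i2; case: (mxtens_indexP j) => j1 j2.
rewrite tensmxE !mxE (inj_eq (can_inj (@mxtens_indexK m n))) xpair_eqE.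
by case: eqP; case: eqP; rewrite ?mulr1 ?mulr0 ?mul0r.
Qed.

(** * Vectors and matrices of all sizes *)

Definition zero_rvec (l : posdvd) : rvec R := @RVec R (val l) (valP l) 0.

Definition vec_tr (k l : posdvd) :=
  let a := (val l %/ val k)%N in kron a 1 (pad (Ecol R a)).

(** Vectors are one-column matrices, enlarged by blocks of width one; the two
    widths [1] and [1 * 1] are convertible. *)
Lemma rvec_plonka : plonka_sum W (@rvec_add R) (@rvec_scale R) zero_rvec.
Proof.
apply: (@PlonkaSum _ _ _ _ _ _ _ _ (fun x => posd (dim_gt0 x))
          (fun x => pad (vec x)) vec_tr) => //.
- move=> [m m0 u] [n n0 v] /= /(congr1 val) /= mn.
  by case: _ / mn in n0 v * => /pad_inj->; congr RVec; apply: bool_irrelevance.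
- by move=> k l; apply: kronD.
- by move=> k l; apply: kronZ.
- by move=> k u; rewrite /vec_tr divnn (valP k) Ecol1 kron1.
- move=> k l m u kl lm; rewrite /vec_tr (divn_trans kl lm) EcolM.
  by rewrite -kron_tens.
- by move=> x y; apply: val_inj.
- by move=> x y; rewrite /= padD !pad_cast !pad_tens.
- by move=> r x; rewrite /= padZ.
- by move=> l; apply: val_inj.
- by move=> l; apply: pad0.
Qed.

Definition zero_rmat (l : posdvd *p posdvd) : rmat R :=
  @RMat R (val l.1) (val l.2) (valP l.1) (valP l.2) 0.

Definition mat_tr (k l : posdvd *p posdvd) :=
  let a := (val l.1 %/ val k.1)%N in let b := (val l.2 %/ val k.2)%N in
  kron a b (pad (Emx R a b)).

(** Rows and columns are enlarged independently, so the lattice is the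
    product of two divisibility lattices. *)
Lemma rmat_plonka : plonka_sum W (@rmat_add R) (@rmat_scale R) zero_rmat.
Proof.
apply: (@PlonkaSum _ _ _ _ _ _ _ _
          (fun A => (posd (nrow_gt0 A), posd (ncol_gt0 A)) : posdvd *p posdvd)
          (fun A => pad (mx A)) mat_tr) => //.
- move=> [m n m0 n0 A] [p q p0 q0 B] /= [mp nq].
  case: _ / mp in p0 B *; case: _ / nq in q0 B * => /pad_inj->.
  by congr RMat; apply: bool_irrelevance.
- by move=> k l; apply: kronD.
- by move=> k l; apply: kronZ.
- by move=> k u; rewrite /mat_tr !divnn (valP k.1) (valP k.2) Emx1 kron1.
- move=> k l m u /andP[kl1 kl2] /andP[lm1 lm2]; rewrite /mat_tr.
  rewrite (divn_trans kl1 lm1) (divn_trans kl2 lm2).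
  by rewrite EmxM -kron_tens.
- by move=> x y; congr pair; apply: val_inj.
- by move=> x y; rewrite /= padD !pad_cast !pad_tens.
- by move=> r x; rewrite /= padZ.
- by move=> [l1 l2]; congr pair; apply: val_inj.
- by move=> l; apply: pad0.
Qed.

Section FixedRatio.
Variables (mu : rat) (mu0 : 0 < mu).
Let muy := `|numq mu|%N.
Let mux := `|denq mu|%N.

Lemma numq_abs_gt0 : (0 < muy)%N.
Proof. by rewrite absz_gt0 numq_eq0 gt_eqF. Qed.

Lemma zero_nrow_gt0 (l : posdvd) : (0 < val l * muy)%N.
Proof. by rewrite muln_gt0 (valP l) numq_abs_gt0. Qed.

Lemma zero_ncol_gt0 (l : posdvd) : (0 < val l * mux)%N.
Proof. by rewrite muln_gt0 (valP l) mux_gt0. Qed.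

Lemma zero_ratio (l : posdvd) :
  Defs.ratio (RMat (zero_nrow_gt0 l) (zero_ncol_gt0 l) (0 : 'M[R]_(_, _))) == mu.
Proof.
have l0 : (val l)%:R != 0 :> rat by rewrite pnatr_eq0 -lt0n (valP l).
rewrite /Defs.ratio /= !natrM -mulf_div divff // mul1r -[eqbRHS]divq_num_den.
by rewrite !natr_absz !ger0_norm ?denq_ge0 // ltW ?numq_gt0.
Qed.

Definition zero_rmat_of (l : posdvd) : rmat_of R mu :=
  exist _ (RMat (zero_nrow_gt0 l) (zero_ncol_gt0 l) 0) (zero_ratio l).

Lemma range_zero_rmat_of : range zero_rmat_of = zero_mats muy mux.
Proof.
apply/seteqP; split=> [_ [l _ <-]|[[m n m0 n0 A] AP] [k [k0 /= mE nE A0]]].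
  by exists (val l); rewrite (valP l).
exists (posd k0) => //; apply: val_inj => /=.
move: (zero_nrow_gt0 _) (zero_ncol_gt0 _) => /=.
move: A0 {AP}; case: _ / (esym mE) in m0 A *; case: _ / (esym nE) in n0 A *.
by move=> -> p q; congr RMat; apply: bool_irrelevance.
Qed.

Variable K : forall k, 'M[R]_k.
Hypothesis K1 : K 1 = 1%:M.
Hypothesis KM : forall m n, K (m * n) = K m *t K n.

Definition sq_tr (k l : posdvd) :=
  let a := (val l %/ val k)%N in kron a a (pad (K a)).

(** In a fixed ratio the [level] determines both dimensions, so that
    divisibility of levels is the only order needed. *)
Lemma rmat_of_plonka :
  plonka_sum W (@rmat_of_sum R mu K) (@rmat_of_scale R mu) zero_rmat_of.
Proof.
apply: (@PlonkaSum _ _ _ _ _ _ _ _ (fun A => posd (level_gt0 A))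
          (fun A => pad (mx (val A))) sq_tr) => //.
- move=> A B /(congr1 val) /= AB.
  have := ncol_level B; have := nrow_level B.
  rewrite -AB -nrow_level -ncol_level.
  case: A B {AB} => [[m n m0 n0 A] AP] [[p q p0 q0 B] BP] /= e1 e2.
  move=> e; apply: val_inj => /=; move: {AP BP} e.
  case: _ / e1 in m0 A *; case: _ / e2 in n0 A * => /pad_inj->.
  by congr RMat; apply: bool_irrelevance.
- by move=> k l; apply: kronD.
- by move=> k l; apply: kronZ.
- by move=> k u; rewrite /sq_tr divnn (valP k) K1 kron1.
- move=> k l m u kl lm; rewrite /sq_tr (divn_trans kl lm) KM.
  by rewrite -kron_tens.
- by move=> A B; apply: val_inj; rewrite /= /level /= mulnK ?numq_abs_gt0.
- by move=> A B; rewrite /= padD !pad_cast !pad_tens.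
- by move=> r A; apply: val_inj.
- by move=> r A; rewrite /= padZ.
- by move=> l; apply: val_inj; rewrite /= /level /= mulnK ?numq_abs_gt0.
- by move=> l; apply: pad0.
Qed.

Lemma rmat_of_hvs : hyper_vector_space_with (@rmat_of_sum R mu K)
  (@rmat_of_scale R mu) (zero_mats muy mux).
Proof. by rewrite -range_zero_rmat_of; apply/plonka_sum_hvs/rmat_of_plonka. Qed.

End FixedRatio.
End PaddedMatrices.

Theorem proposition8p4 (R : realType) :
  [/\ hyper_vector_space (@rvec_add R) (@rvec_scale R),
      hyper_vector_space (@rmat_of_add_bar R 1%R) (@rmat_of_scale R 1%R) /\
      hyper_vector_space (@rmat_of_add_hat R 1%R) (@rmat_of_scale R 1%R),
      forall muy mux : nat, 0 < muy -> 0 < mux -> coprime muy mux ->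
        let mu : rat := (muy%:R / mux%:R)%R in
        hyper_vector_space_with (@rmat_of_add_hat R mu) (@rmat_of_scale R mu)
          (zero_mats muy mux) &
      hyper_vector_space (@rmat_add R) (@rmat_scale R)].
Proof.
have hat (mu : rat) : (0 < mu)%R -> hyper_vector_space_with
    (@rmat_of_add_hat R mu) (@rmat_of_scale R mu)
    (zero_mats `|numq mu| `|denq mu|).
  by move=> mu0; apply: rmat_of_hvs => // [|m n]; [exact: Emx1|exact: EmxM].
split.
- by eexists; apply/plonka_sum_hvs/rvec_plonka.
- split; eexists; last exact: hat.
  by apply: rmat_of_hvs => // m n; apply: scalar1_tens.
- move=> muy mux muy0 mux0 cop mu.
  have mu0 : (0 < mu)%R by rewrite divr_gt0 // ltr0n.
  have num : numq mu = Posz muy.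
    by rewrite (@coprimeq_num (Posz muy) (Posz mux)) // gtr0_sg ?mul1r.
  have den : denq mu = Posz mux.
    rewrite (@coprimeq_den (Posz muy) (Posz mux)) //.
    by case: ifP => // /eqP[mux_0]; rewrite mux_0 in mux0.
  by have := hat mu mu0; rewrite num den.
- by eexists; apply/plonka_sum_hvs/rmat_plonka.
Qed.
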